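(* Let $k$ be a field, $S=k[x_1,x_2,x_3]$, and let $N=\bigoplus_{i=1}^{r} S/(x_1,x_2,x_3^{n_i})$ for some positive integers $n_1,\dots,n_r$. Let $I\subseteq K\subseteq S$ and $J\subseteq L\subseteq S$ be monomial ideals with $\dim_k S/I<\infty$ and $\dim_k S/J<\infty$, such that $K/I\cong N$ as $S$-modules, and let $\phi\colon K/I\to L/J$ be an isomorphism of $S$-modules sending monomials to monomials. Put \[ M=(S/I\oplus S/J)\big/\langle (f,-\phi(f)) \mid f\in K/I\rangle , \] let $d=\dim_k M$, let $A_i$ ($i=1,2,3$) be the $d\times d$ matrix of the $k$-linear map $M\to M$, $m\mapsto x_i m$, with respect to the natural monomial basis of $M$, and let $\mathcal{A}$ be the unital $k$-algebra generated by $A_1,A_2,A_3$. Then $\dim_k\mathcal{A}\le d$.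
   Context: An $S$-module isomorphism $\phi\colon K/I\to L/J$ ''sends monomials to monomials'' if for every monomial $x^a\in K\setminus I$, the image under $\phi$ of the class of $x^a$ is the class of some monomial $x^{a'}\in L\setminus J$. The natural monomial basis of $M$ consists of the images of the classes of monomials of $S/I$ and $S/J$ (with identified monomials counted once). The matrices $A_i$ pairwise commute. *)

(* Defs.v *)
From HB Require Import structures.
From mathcomp Require Import all_boot all_order all_algebra.
Set Implicit Arguments. Unset Strict Implicit. Unset Printing Implicit Defensive.
Import GRing.Theory.
Local Open Scope ring_scope.

(* Monomials of S = k[x_1,x_2,x_3] are identified with exponent vectors;
   index i : 'I_3 stands for the variable x_(i+1). *)
Definition mono := {ffun 'I_3 -> nat}.

Definition shift (a : mono) (i : 'I_3) : mono := [ffun j => (a j + (j == i))%N].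

(* A monomial ideal is determined by the set of monomials it contains,
   which is exactly an up-closed set of exponent vectors. *)
Definition mono_ideal (I : mono -> bool) : Prop :=
  forall a i, I a -> I (shift a i).

(* dim_k S/I < oo, witnessed by a box [0,D)^3 containing all standard monomials *)
Definition bounded (D : nat) (I : mono -> bool) : Prop :=
  forall a, ~~ I a -> forall j, (a j < D)%N.

Definition emb D (a : {ffun 'I_3 -> 'I_D}) : mono := [ffun j => nat_of_ord (a j)].

(* monomial basis of K/I (for I with standard monomials in the box [0,D)^3) *)
Definition QBp D (K I : mono -> bool) : pred {ffun 'I_3 -> 'I_D} :=
  fun a => K (emb a) && ~~ I (emb a).
Definition QB D (K I : mono -> bool) : finType := {a : {ffun 'I_3 -> 'I_D} | QBp K I a}.

Definition mx_of (k : nzRingType) (T U : finType) (f : T -> U -> k)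
  : 'M[k]_(#|T|, #|U|) := \matrix_(i, j) f (enum_val i) (enum_val j).

(* Column convention: entry (b', b) = coefficient of b' in x_i * b. *)
Definition actQ (k : nzRingType) D (K I : mono -> bool) (i : 'I_3)
  : 'M[k]_(#|QB D K I|, #|QB D K I|) :=
  mx_of (fun b' b : QB D K I => ((emb (val b') == shift (emb (val b)) i) : nat)%:R).

(* N = (+)_{i<r} S/(x_1,x_2,x_3^{n_i}), monomial basis {(i, x_3^j) : j < n_i} *)
Definition NB r (n : 'I_r -> nat) : finType := {i : 'I_r & 'I_(n i)}.

Definition actN (k : nzRingType) r (n : 'I_r -> nat) (i : 'I_3)
  : 'M[k]_(#|NB n|, #|NB n|) :=
  mx_of (fun u v : NB n =>
    (([&& nat_of_ord i == 2%N, tag u == tag v &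
         nat_of_ord (tagged u) == (nat_of_ord (tagged v)).+1]) : nat)%:R).

Definition smod_iso (k : fieldType) m n (X : 'I_3 -> 'M[k]_(m, m))
  (Y : 'I_3 -> 'M[k]_(n, n)) : Prop :=
  exists P : 'M[k]_(n, m),
    [/\ row_free P, row_full P & forall i, P *m X i = Y i *m P].

(* the k-linear map K/I -> L/J sending the class of x^a to the class of x^(sigma a);
   these are exactly the k-linear maps sending monomials to monomials. *)
Definition mono_map (k : nzRingType) D (K I L J : mono -> bool)
  (sigma : QB D K I -> QB D L J) : 'M[k]_(#|QB D L J|, #|QB D K I|) :=
  mx_of (fun c a => ((sigma a == c) : nat)%:R).

Definition mono_smod_iso (k : fieldType) D (K I L J : mono -> bool)
  (sigma : QB D K I -> QB D L J) : Prop :=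
  [/\ row_free (mono_map k sigma), row_full (mono_map k sigma) &
      forall i, mono_map k sigma *m actQ k D K I i = actQ k D L J i *m mono_map k sigma].

(* Monomials of S/I (+) S/J : inl for the S/I summand, inr for the S/J summand. *)
Definition shiftS (u : mono + mono) (i : 'I_3) : mono + mono :=
  match u with inl a => inl (shift a i) | inr c => inr (shift c i) end.

Definition std_at (I J : mono -> bool) (u : mono + mono) : bool :=
  match u with inl a => ~~ I a | inr c => ~~ J c end.

(* identification in M of the monomials (x^a, 0) and (0, phi(x^a)) *)
Definition identified D (K I L J : mono -> bool) (sigma : QB D K I -> QB D L J)
  (u v : mono + mono) : bool :=
  (u == v) ||
  match u, v with
  | inl a, inr c | inr c, inl a =>
      [exists x : QB D K I, (emb (val x) == a) && (emb (val (sigma x)) == c)]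
  | _, _ => false
  end.

(* natural monomial basis of M: all monomials of S/I, together with the
   monomials of S/J not in L (those in L \ J are identified with monomials of K/I). *)
Definition MB D (I L : mono -> bool) : finType :=
  ({a : {ffun 'I_3 -> 'I_D} | ~~ I (emb a)} + {c : {ffun 'I_3 -> 'I_D} | ~~ L (emb c)})%type.

Definition rep D (I L : mono -> bool) (b : MB D I L) : mono + mono :=
  match b : ({a : {ffun 'I_3 -> 'I_D} | ~~ I (emb a)} + {c : {ffun 'I_3 -> 'I_D} | ~~ L (emb c)})%type
  with inl a => inl (emb (val a)) | inr c => inr (emb (val c)) end.

(* A_i : the matrix of m |-> x_i m on M in its natural monomial basis:
   the column of b has a 1 in the row of the basis monomial equal in M to x_i * b
   (and is zero when x_i * b vanishes in S/I (+) S/J). *)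
Definition Amat (k : nzRingType) D (I J K L : mono -> bool)
  (sigma : QB D K I -> QB D L J) (i : 'I_3) : 'M[k]_(#|MB D I L|, #|MB D I L|) :=
  mx_of (fun b' b : MB D I L =>
    ((std_at I J (shiftS (rep b) i) &&
      identified sigma (shiftS (rep b) i) (rep b')) : nat)%:R).

Definition wprod (k : nzRingType) d (A : 'I_3 -> 'M[k]_(d, d)) (w : seq 'I_3) : 'M[k]_(d, d) :=
  foldr (fun i B => A i *m B) 1%:M w.

(* span of all words of length < n in A_1, A_2, A_3 (including the empty word = 1);
   the unital algebra generated by A_1,A_2,A_3 is the union of this increasing chain. *)
Definition words_span (k : fieldType) d (A : 'I_3 -> 'M[k]_(d, d)) (n : nat)
  : {vspace 'M[k]_(d, d)} :=
  (\sum_(m < n) <<[seq wprod A (tval w) | w : m.-tuple 'I_3]>>)%VS.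

(* Main.v *)
(* The annihilator of [M] is the intersection of [I] and [J], so the claim amounts to
   [dim K/I <= dim S/(I + J)].  As x_1 and x_2 kill [K/I], the monomials of [K/I] form
   vertical columns sitting on top of the columns of [S/I]; slicing [S/I] by the exponent
   [h] of x_3 gives a decreasing family of Young diagrams, and each column of [K/I] is a
   removable corner of the diagram at every height it occupies.  The same holds for [J],
   and [sigma] matches the columns on both sides, preserving lengths.  A diagram with [k]
   corners contains the staircase of size [k], which bounds from below the number [G h] of
   cells common to the two diagrams at height [h].  It remains to give every matched pair
   of columns as many heights as its length, no height [h] being used more than [G h]
   times.  While both families still have at least three simultaneous columns at or above
   [h], the lower column of each pair will do.  Once one family never has more than two
   simultaneous columns, each pair uses one of its two columns, or else all heights below
   a suitable level. *)

Require Import Defs.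
From HB Require Import structures.
From mathcomp Require Import all_boot all_order all_algebra.
From mathcomp Require Import zify.
Set Implicit Arguments. Unset Strict Implicit. Unset Printing Implicit Defensive.

(** * Young diagrams, corners and staircases *)

Definition young (A : pred (nat * nat)) : Prop :=
  forall x y x' y', x' <= x -> y' <= y -> A (x, y) -> A (x', y').

Definition staircase k : pred (nat * nat) := fun u => u.1 + u.2 < k.

Definition region D (A : pred (nat * nat)) : seq (nat * nat) :=
  [seq u <- [seq (x, y) | x <- iota 0 D, y <- iota 0 D] | A u].

Definition boxed D (A : pred (nat * nat)) : Prop :=
  forall x y, A (x, y) -> (x < D) && (y < D).

Lemma mem_region D A : boxed D A -> region D A =i A.
Proof.
move=> bA [x y]; rewrite mem_filter -[RHS]/(A (x, y)).
case Axy: (A (x, y)) => //=; have /andP[xD yD] := bA _ _ Axy.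
by apply/allpairsP; exists (x, y); rewrite !mem_iota.
Qed.

Lemma region_uniq D A : uniq (region D A).
Proof.
by apply/filter_uniq/allpairs_uniq; rewrite ?iota_uniq // => -[? ?] [? ?].
Qed.

(** Distinct corners lie in distinct rows and distinct columns. If the cell (x, y) is missing from
    [A], every corner has first coordinate below x or second coordinate below y, so there are at
    most x + y corners. *)
Lemma staircase_corners (Z : finType) (C : {set Z}) (p : Z -> nat * nat) A :
  young A -> injective p ->
  {in C, forall z, [/\ A (p z), ~~ A ((p z).1.+1, (p z).2)
                     & ~~ A ((p z).1, (p z).2.+1)]} ->
  forall u, staircase #|C| u -> A u.
Proof.
move=> yA injp cornC [x y]; rewrite /staircase /= => ltxy.
case Axy: (A (x, y)) => //.
have near z : z \in C -> ((p z).1 < x) || ((p z).2 < y).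
  move=> /cornC[Apz _ _]; case: ltnP => //= lex; case: ltnP => //= ley.
  by rewrite -Axy; apply: yA lex ley _; rewrite -surjective_pairing.
have pair_eq (u v : nat * nat) : u.1 = v.1 -> u.2 = v.2 -> u = v.
  by case: u v => [? ?] [? ?] /= -> ->.
(* A corner left of x is coded by its column, any other one by x plus its row: an injection into [0,
   x + y). *)
pose f z := if (p z).1 < x then (p z).1 else x + (p z).2.
have row z z' : z \in C -> z' \in C -> (p z).1 = (p z').1 -> z = z'.
  move=> /cornC[Az _ nz] /cornC[Az' _ nz'] e1; apply: injp.
  apply: pair_eq => //; apply/eqP; rewrite eqn_leq; apply/andP; split; rewrite leqNgt.
    apply: contra nz' => lt; apply: yA (leqnn _) lt _.
    by rewrite -e1 -surjective_pairing.
  by apply: contra nz => lt; apply: yA (leqnn _) lt _; rewrite e1 -surjective_pairing.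
have col z z' : z \in C -> z' \in C -> (p z).2 = (p z').2 -> z = z'.
  move=> /cornC[Az nz _] /cornC[Az' nz' _] e1; apply: injp.
  apply: pair_eq => //; apply/eqP; rewrite eqn_leq; apply/andP; split; rewrite leqNgt.
    apply: contra nz' => lt; apply: yA lt (leqnn _) _.
    by rewrite -e1 -surjective_pairing.
  by apply: contra nz => lt; apply: yA lt (leqnn _) _; rewrite e1 -surjective_pairing.
suff: #|C| <= x + y by lia.
rewrite cardE -(size_map f) -[leqRHS](size_iota 0); apply: uniq_leq_size.
  rewrite map_inj_in_uniq ?enum_uniq // => z z'; rewrite !mem_enum /f => Cz Cz'.
  case: ltnP => lt1; case: ltnP => lt2; try (move=> ?; lia).
    exact: row.
  by move/eqP; rewrite eqn_add2l => /eqP; apply: col.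
move=> i /mapP[z]; rewrite mem_enum => /near nz ->.
rewrite mem_iota /f; case: (ltnP (p z).1 x) nz => /= ? ?; lia.
Qed.

(* If [B] leaves the staircase of size [k], it meets every diagonal
   [x + y = r], [r < k]; below [j] it contains the whole diagonal. *)
Lemma region_staircases D A B k j :
  young B -> boxed D A -> boxed D B ->
  (forall u, staircase k u -> A u) -> (forall u, staircase j u -> B u) -> j <= k ->
  minn (size (region D B)) (k - j + 'C(j.+1, 2)) <= size (region D (predI A B)).
Proof.
move=> yB bA bB sA sB lejk.
have bAB : boxed D (predI A B) by move=> x y /andP[/bA].
have [/allP inB | /allPn[[a b]]] := boolP (all (staircase k) (region D B)).
  apply: leq_trans (geq_minl _ _) _; apply: uniq_leq_size (region_uniq _ _) _.
  move=> u uB; rewrite mem_region // inE /= sA ?inB //=.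
  by rewrite mem_region in uB.
rewrite mem_region // /staircase /= -leqNgt => Bab ltk.
apply: leq_trans (geq_minr _ _) _.
(* [s1] lists the staircase of size [j]. [s2] has one cell on each diagonal [r] with j <= r < k,
   chosen below (a, b) and hence in [B]; this is possible since a + b >= k > r. *)
pose s1 := [seq (x, r - x) | r <- iota 0 j, x <- iota 0 r.+1].
pose s2 := [seq (minn a r, r - minn a r) | r <- iota j (k - j)].
have -> : k - j + 'C(j.+1, 2) = size (s1 ++ s2).
  rewrite size_cat size_map size_iota addnC; congr (_ + _).
  rewrite size_allpairs_dep.
  elim: j {lejk sB s1 s2} => // j IHj.
  have -> : iota 0 j.+1 = iota 0 j ++ [:: j] by rewrite -addn1 iotaD.
  by rewrite map_cat sumn_cat -IHj /= size_iota addn0 binS bin1 addnC.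
apply: uniq_leq_size.
  rewrite cat_uniq; apply/and3P; split.
  - apply: allpairs_uniq_dep => [|r _|]; rewrite ?iota_uniq //.
    move=> u v /allpairsPdep[r1 [x1 [_ x1r ->]]] /allpairsPdep[r2 [x2 [_ x2r ->]]].
    move: x1r x2r; rewrite !mem_iota /= => lt1 lt2 [e1 e2].
    have er : r1 = r2 by lia.
    by subst r2; rewrite e1.
  - apply/hasPn => _ /mapP[r +] ->; rewrite mem_iota => r_in.
    apply/negP => /allpairsPdep[r' [x [+ + [e1 e2]]]].
    rewrite !mem_iota; lia.
  - rewrite map_inj_in_uniq ?iota_uniq // => r r' _ _ [e1 e2].
    lia.
move=> u; rewrite mem_cat mem_region // inE => /orP[/allpairsPdep|/mapP].
  move=> [r [x [+ + ->]]]; rewrite !mem_iota => rj xr.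
  by rewrite sA ?sB // /staircase /=; lia.
move=> [r]; rewrite mem_iota => r_in ->; rewrite sA /staircase /=; last lia.
by apply: yB Bab; lia.
Qed.

(** * Matched families of intervals *)

Section MatchedIntervals.

Variables (Z : finType) (D : nat).
Implicit Types (e l : Z -> nat) (G : nat -> nat) (V : nat -> {set Z}).

(* The interval of [z] is [e z - l z, ..., e z - 1]. *)
Definition covering e l h : {set Z} := [set z | e z - l z <= h < e z].
Definition above e h : {set Z} := [set z | h < e z].

Lemma above_anti e h h' : h <= h' -> above e h' \subset above e h.
Proof. by move=> leh; apply/subsetP => z; rewrite !inE; lia. Qed.

Lemma cover_above e l h : covering e l h \subset above e h.
Proof. by apply/subsetP => z; rewrite !inE; lia. Qed.

(** [G h] stands for the number of cells shared by two diagrams at height [h]. Diagrams shrink with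
    height, so corners at [h1] and [h2] give staircases of sizes [k] and [j] at [h], as in
    [region_staircases]; [#|above e2 h|] bounds the size of the second diagram from below. *)
Definition staircase_bound (G : nat -> nat) e1 e2 l : Prop :=
  forall h h1 h2 k j, h <= h1 -> h <= h2 ->
    k <= #|covering e1 l h1| -> j <= #|covering e2 l h2| -> j <= k ->
  minn #|above e2 h| (k - j + 'C(j.+1, 2)) <= G h.

(** [V h] is the set of indices to which level [h] is given; the pairs (z, h) are counted in both
    orders. *)
Lemma double_count V G (r : Z -> nat) a b :
  (forall h, a <= h < b -> #|V h| <= G h) ->
  (forall z, r z <= \sum_(a <= h < b) (z \in V h)) ->
  \sum_z r z <= \sum_(a <= h < b) G h.
Proof.
move=> leG ler; apply: leq_trans (leq_sum _ (fun z _ => ler z)) _.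
rewrite exchange_big big_nat [leqRHS]big_nat /=; apply: leq_sum => h /leG.
by rewrite -sum1_card [leqLHS]big_mkcond.
Qed.

Lemma count_interval (P : pred nat) a b a' b' : a <= a' -> b' <= b ->
  (forall h, a' <= h < b' -> P h) -> b' - a' <= \sum_(a <= h < b) P h.
Proof.
move=> lea leb PP; case: (leqP b' a') => [?|ltab]; first lia.
rewrite (@big_cat_nat _ _ _ a') //=; last lia.
rewrite (@big_cat_nat _ _ _ b' a') //=; last lia.
rewrite addnCA; apply: leq_trans (leq_addr _ _).
rewrite -[leqLHS]muln1 -sum_nat_const_nat big_nat [leqRHS]big_nat.
by apply: leq_sum => h /PP ->.
Qed.

Lemma count_cover e l V t z : e z <= D ->
  (forall h, t <= h < D -> z \in covering e l h -> z \in V h) ->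
  minn (l z) (e z - t) <= \sum_(t <= h < D) (z \in V h).
Proof.
move=> ezD cV; apply: (@leq_trans (e z - maxn t (e z - l z))); first lia.
apply: count_interval => // [|h]; first lia.
by move=> ?; apply: cV; rewrite ?inE; lia.
Qed.

Lemma ex_max_nat (P : pred nat) a b :
  (exists2 h, a <= h < b & P h) ->
  exists h, [/\ a <= h < b, P h & forall h', h < h' < b -> ~~ P h'].
Proof.
move=> [h0 h0ab Ph0].
have exP : exists i, (a <= i < b) && P i by exists h0; rewrite h0ab.
have bdP i : (a <= i < b) && P i -> i <= b by lia.
case: (ex_maxnP exP bdP) => h /andP[hab Ph] hmax; exists h; split=> // h' hh'.
apply/negP => Ph'; have := hmax h'; rewrite Ph' andbT; lia.
Qed.

(* Above level [t] the second system has depth at most 2. *)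
Section Zone.

Variables (G : nat -> nat) (e e' l : Z -> nat) (t : nat).
Hypothesis GP : staircase_bound G e e' l.
Hypothesis GQ : staircase_bound G e' e l.
Hypothesis eD : forall z, e z <= D.
Hypothesis e'D : forall z, e' z <= D.
Hypothesis thin : forall h, t <= h < D -> #|covering e' l h| <= 2.

(** The size of the part of the interval of [z] at or above [t], in the system where this part is
    shorter: it is guaranteed whichever of the two intervals [z] uses. *)
Let r z := minn (l z) (minn (e z - t) (e' z - t)).

(* It is enough to give each [z] a set of levels containing one of its two
   intervals, so that no level [h] is given to more than [G h] indices. *)
Let zone_cover V :
  (forall h, t <= h < D -> #|V h| <= G h) ->
  (forall z, (forall h, t <= h < D -> z \in covering e l h -> z \in V h) \/
             (forall h, t <= h < D -> z \in covering e' l h -> z \in V h)) ->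
  \sum_z r z <= \sum_(t <= h < D) G h.
Proof.
move=> VG cV; apply: double_count VG _ => z.
case: (cV z) => /count_cover => [/(_ (eD z))|/(_ (e'D z))]; rewrite /r; lia.
Qed.

Let minGP h h1 k : h <= h1 -> k <= #|covering e l h1| -> k <= #|above e' h| -> k <= G h.
Proof.
move=> hh1 kc km; have := @GP h h1 h k 0 hh1 (leqnn _) kc (leq0n _) (leq0n _).
rewrite bin_small //; lia.
Qed.

Let minGQ h h1 k : h <= h1 -> k <= #|covering e' l h1| -> k <= #|above e h| -> k <= G h.
Proof.
move=> hh1 kc km; have := @GQ h h1 h k 0 hh1 (leqnn _) kc (leq0n _) (leq0n _).
rewrite bin_small //; lia.
Qed.

(** For j = 2 the staircase term is k - 2 + 3 = k + 1, one more than for j = 0 in [minGP]; this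
    extra cell settles the tight cases below. *)
Let minGP2 h h1 h2 k : h <= h1 -> h <= h2 -> 2 <= k ->
  k <= #|covering e l h1| -> 2 <= #|covering e' l h2| -> k < #|above e' h| -> k < G h.
Proof.
move=> hh1 hh2 k2 kc c2 km; have := @GP h h1 h2 k 2 hh1 hh2 kc c2 k2.
have -> : 'C(3, 2) = 3 by []. lia.
Qed.

Let above_le e0 h h' : h <= h' -> #|above e0 h'| <= #|above e0 h|.
Proof. by move=> ?; apply/subset_leq_card/above_anti. Qed.

Let cover_le e0 h : #|covering e0 l h| <= #|above e0 h|.
Proof. exact/subset_leq_card/cover_above. Qed.

(** Indices in [T] use their first interval, the others their second one. Above [hA] only [T]
    matters. Up to [hA], [thin] adds at most two indices to [T]: one is paid by [minGP], the first
    system having depth larger than [#|T|] at [hA]; two are paid by [minGP2] if [T] is nonempty, and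
    by the second alternative if it is empty. *)
Lemma zone_overhang (hA : nat) :
  t <= hA < D -> #|above e' hA| < #|covering e l hA| ->
  (forall h, hA < h < D -> #|covering e l h| <= #|above e' h|) ->
  0 < #|above e' hA| \/
    (forall h, t <= h <= hA -> #|covering e' l h| <= #|above e h|) ->
  \sum_z r z <= \sum_(t <= h < D) G h.
Proof.
move=> hAD ltA geA alt; pose T := above e' hA; rewrite -/T in ltA alt.
pose V h := [set z | if z \in T then (h <= hA) || (z \in covering e l h)
                     else z \in covering e' l h].
apply: (zone_cover (V := V)) => [h htD|z]; last first.
  case zT: (z \in T); [left|right] => h _ zc; rewrite in_set zT.
    by rewrite zc orbT.
  by rewrite zc.
have [hhA|hAh] := leqP h hA; last first.
  apply: (@leq_trans #|covering e l h|); last first.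
    by apply: (minGP (leqnn h) (leqnn _)); apply: geA; lia.
  apply: subset_leq_card; apply/subsetP => z; rewrite !inE (leqNgt h) hAh /=.
  by case: ifP => // /negbT; rewrite -leqNgt; lia.
have VE : V h = T :|: (covering e' l h :\: T).
  by apply/setP => z; rewrite !inE; case: ltnP => //=; rewrite hhA.
have cardV : #|V h| = #|T| + #|covering e' l h :\: T|.
  rewrite VE cardsU (_ : T :&: _ = set0) ?cards0 ?subn0 //.
  by apply/setP => z; rewrite !inE; case: ltnP.
have leV : #|V h| <= #|above e' h|.
  apply: subset_leq_card; rewrite VE subUset above_anti //=.
  exact: subset_trans (subsetDl _ _) (cover_above _ _ _).
have x2 : #|covering e' l h :\: T| <= #|covering e' l h| by apply/subset_leq_card/subsetDl.
have c2 := thin htD.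
have [x1|x1] := leqP #|covering e' l h :\: T| 1.
  by apply: minGP hhA _ leV; rewrite cardV; lia.
have [T0|Tpos] := posnP #|T|; last first.
  have -> : #|V h| = #|T|.+2 by lia.
  by apply: (@minGP2 h hA h); lia.
case: alt => [|alt]; first by rewrite T0.
apply: (@minGQ h h _ (leqnn _)); first by lia.
rewrite cardV T0 add0n; apply: leq_trans x2 _; apply: alt; lia.
Qed.


(* The levels where the depth of one system exceeds the number of intervals of
   the other ending above are the obstructions; [hA], [hB] are the highest ones,
   [hC] the highest level where the correction made below [hB] still fails. *)
Lemma zone_sum : \sum_z r z <= \sum_(t <= h < D) G h.
Proof.
have coverP : (forall h, t <= h < D -> #|covering e l h| <= #|above e' h|) ->
    \sum_z r z <= \sum_(t <= h < D) G h.
  move=> cP; apply: (zone_cover (V := covering e l)) => [h htD|z]; last by left.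
  exact: (@minGP h h _ (leqnn _) (leqnn _)) (cP h htD).
have coverQ : (forall h, t <= h < D -> #|covering e' l h| <= #|above e h|) ->
    \sum_z r z <= \sum_(t <= h < D) G h.
  move=> cQ; apply: (zone_cover (V := covering e' l)) => [h htD|z]; last by right.
  exact: (@minGQ h h _ (leqnn _) (leqnn _)) (cQ h htD).
pose badP h := #|above e' h| < #|covering e l h|.
pose badQ h := #|above e h| < #|covering e' l h|.
have [hasA|noA] := boolP (has badP (index_iota t D)); last first.
  apply: coverP => h htD; rewrite leqNgt; apply: (hasPn noA).
  by rewrite mem_index_iota.
have [|hA [hAD ltA maxA]] := @ex_max_nat badP t D.
  by case/hasP: hasA => h; rewrite mem_index_iota; exists h.
have geA h : hA < h < D -> #|covering e l h| <= #|above e' h|.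
  by move=> /maxA; rewrite /badP -leqNgt.
have overhang := zone_overhang hAD ltA geA.
have [M0|Mpos] := posnP #|above e' hA|; last by apply: overhang; left.
have [hasB|noB] := boolP (has badQ (index_iota t hA.+1)); last first.
  apply: overhang; right => h htA; rewrite leqNgt; apply: (hasPn noB).
  by rewrite mem_index_iota ltnS.
have [|hB [hBA ltB maxB]] := @ex_max_nat badQ t hA.+1.
  by case/hasP: hasB => h; rewrite mem_index_iota; exists h.
have mB1 : 0 < #|above e hB|.
  have leAB : #|above e hA| <= #|above e hB| by apply: above_le; lia.
  by move: ltA; rewrite /badP; have := cover_le e hA; lia.
have c2B : #|covering e' l hB| <= 2 by apply: thin; lia.
(* A positive number smaller than a number at most 2: a single index [x0] has its first interval
   ending above [hB]. *)
have {mB1 c2B} [mB cB] : #|above e hB| = 1 /\ #|covering e' l hB| = 2.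
  by move: ltB; rewrite /badQ; lia.
have geQ h : hB < h < D -> #|covering e' l h| <= #|above e h|.
  move=> hh; have [hhA|hAh] := leqP h hA.
    by have := maxB h; rewrite /badQ -leqNgt; apply; lia.
  apply: leq_trans (cover_le e' h) _.
  by apply: leq_trans (above_le e' (ltnW hAh)) _; rewrite M0.
have /cards1P[x0 aboveB] : #|above e hB| == 1 by rewrite mB.
have above_x z : (hB < e z) = (z == x0).
  by have := in_set1 z x0; rewrite -aboveB inE.
pose y h := #|covering e l h :\ x0|.
have ley h : y h <= #|covering e l h| by apply/subset_leq_card/subD1set.
have lty h : h <= hB -> y h < #|above e h|.
  move=> hhB; rewrite [leqRHS](cardsD1 x0) inE.
  rewrite (_ : h < e x0); last by have := above_x x0; rewrite eqxx; lia.
  by rewrite add1n ltnS; apply/subset_leq_card/setSD/cover_above.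
pose bad h := G h <= y h.
have [hasC|noC] := boolP (has bad (index_iota t hB.+1)); last first.
  (* First correction: [x0] moves to its second interval, all others keep the first. Up to [hB] a
     level goes to at most [y h] + 1 indices, which fits unless the level is [bad]. *)
  pose V h := [set z | if z == x0 then (h <= hB) || (z \in covering e' l h)
                       else z \in covering e l h].
  apply: (zone_cover (V := V)) => [h htD|z]; last first.
    case zT: (z == x0); [right|left] => h _ zc; rewrite in_set zT.
      by rewrite zc orbT.
    by rewrite zc.
  have [hhB|hBh] := leqP h hB; last first.
    apply: (@leq_trans #|covering e' l h|); last first.
      by apply: (minGQ (leqnn h) (leqnn _)); apply: geQ; lia.
    apply: subset_leq_card; apply/subsetP => z; rewrite in_set leqNgt hBh /=.
    case: eqP => // /eqP/negbTE; rewrite -above_x !inE; lia.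
  have VE : V h \subset x0 |: (covering e l h :\ x0).
    by apply/subsetP => z; rewrite !inE; case: eqP.
  apply: leq_trans (subset_leq_card VE) _; rewrite cardsU1 !inE eqxx /= add1n.
  have := hasPn noC h; rewrite mem_index_iota /bad -ltnNge; apply; lia.
have [|hC [hCB badC maxC]] := @ex_max_nat bad t hB.+1.
  by case/hasP: hasC => h; rewrite mem_index_iota; exists h.
have hCB' : hC <= hB by lia.
have ltyC := lty hC hCB'.
(* If [y hC] were 0 or 1, the two second intervals over [hB] would force [G hC] to exceed it; for 1,
   the sizes 2 and 1 give the staircase term 2 - 1 + 1 = 2. *)
have y2 : 2 <= y hC.
  rewrite leqNgt; apply/negP => y1; move: badC; rewrite /bad leqNgt => /negP[].
  have [y0|ypos] := posnP (y hC).
    by rewrite y0; apply: (minGQ hCB'); [rewrite cB | lia].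
  have -> : y hC = 1 by lia.
  have := @GQ hC hB hC 2 1 hCB' (leqnn _) _ _ isT; rewrite cB (leq_trans ypos) //.
  by move=> /(_ isT isT); rewrite (_ : 'C(2, 2) = 1) //; lia.
have leiy : #|above e' hC| <= y hC.
  rewrite leqNgt; apply/negP => lti; move: badC; rewrite /bad leqNgt => /negP[].
  by apply: (minGP2 (leqnn _) hCB' y2 (ley hC)); rewrite ?cB.
pose T := above e' hC.
have T2 : 2 <= #|T|.
  by rewrite -cB; apply: leq_trans (cover_le e' hB) (above_le e' hCB').
(* [w] is [x0] if [x0] lies in [T], so that no other member of [T] has a first interval ending above
   [hB]. *)
have [w wT wx] : exists2 w, w \in T & forall z, z \in T -> z != w -> z != x0.
  case xT: (x0 \in T); first by exists x0.
  have /card_gt0P[w wT] : 0 < #|T| by lia.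
  by exists w => // z zT _; apply: contraFN xT => /eqP <-.
(* Second correction: [w] and the indices outside [T] use the second interval, the rest of [T] the
   first. Above [hB] only second intervals remain; between [hC] and [hB] the maximality of [hC]
   applies; up to [hC], [thin] adds at most two indices to [T :\ w]. *)
pose V h := [set z | if z == w then (hC < h <= hB) || (z \in covering e' l h)
                     else if z \in T then (h <= hC) || (z \in covering e l h)
                     else z \in covering e' l h].
apply: (zone_cover (V := V)) => [h htD|z]; last first.
  case: (eqVneq z w) => [zw|zw]; first by right=> h _ zc; rewrite in_set zw eqxx -zw zc orbT.
  case zT: (z \in T); [left|right] => h _ zc; rewrite in_set (negbTE zw) zT zc ?orbT //.
have notT z : z \notin T -> hC <= h -> (z \in covering e' l h) = false.
  by rewrite !inE; lia.
have [hBh|hhB] := ltnP hB h.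
  apply: (@leq_trans #|covering e' l h|); last first.
    by apply: (minGQ (leqnn h) (leqnn _)); apply: geQ; lia.
  apply: subset_leq_card; apply/subsetP => z; rewrite in_set.
  rewrite (leqNgt h hB) hBh andbF /=; case: eqVneq => // zw.
  case: ifP => // zT; rewrite leqNgt (leq_ltn_trans hCB' hBh) /=.
  by have := wx z zT zw; rewrite -above_x !inE; lia.
have [hCh|hhC] := ltnP hC h.
  have VE : V h \subset w |: (covering e l h :\ x0).
    apply/subsetP => z; rewrite in_set in_setU1 in_setD1; case: eqVneq => //= zw.
    case: ifP => [zT|/negbT/notT->//]; last by lia.
    by rewrite leqNgt hCh /= => ->; rewrite wx.
  apply: leq_trans (subset_leq_card VE) _; rewrite cardsU1.
  have := maxC h; rewrite /bad -ltnNge => /(_ ltac:(lia)); rewrite -/(y h).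
  by case: (w \notin _) => /=; lia.
have i0 : #|T| <= #|covering e l hC| by rewrite (leq_trans leiy).
have dT : #|T| = #|T :\ w|.+1 by rewrite (cardsD1 w) wT.
pose X := covering e' l h :\: (T :\ w).
have VE : V h = (T :\ w) :|: X.
  apply/setP => z; rewrite in_set !in_setU !in_setD !in_set1 hhC ltnNge hhC /=.
  by case: eqVneq => //= _; case: (z \in T).
have cardV : #|V h| <= #|T :\ w| + #|X|.
  by rewrite VE cardsU leq_subr.
have c2 := thin htD.
have X2 : #|X| <= #|covering e' l h| by apply/subset_leq_card/subsetDl.
have [X1|X1] := leqP #|X| 1.
  apply: leq_trans (_ : #|T| <= _); first by lia.
  exact: (minGP hhC i0 (above_le e' hhC)).
(* [X] has two elements here, so one of them differs from [w] and lies in [above e' h] outside [T]: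
   this is the strict inequality required by [minGP2]. *)
have iG : #|T| < G h.
  apply: (minGP2 hhC (leq_trans hhC hCB') T2 i0); rewrite ?cB //.
  rewrite -/T; have : (T \proper above e' h); last by move/proper_card.
  rewrite properEneq above_anti // andbT; apply/eqP => TE.
  have : X \subset [set w].
    apply/subsetP => z; rewrite in_setD in_setD1 in_set1 => /andP[+ zc].
    by rewrite TE (subsetP (cover_above _ _ _) _ zc) andbT negbK.
  by move/subset_leq_card; rewrite cards1; lia.
by apply: leq_trans iG; lia.
Qed.

End Zone.

(* Of each matched pair take the lower interval: at level [h] these are some of
   the corners of one diagram and some of the other one, and for [j, k >= 3] the
   staircase bound [k - j + 'C(j.+1, 2)] is at least [k + j]. *)
Lemma lower_interval_bound G e e' l h h1 h2 :
  staircase_bound G e e' l -> staircase_bound G e' e l ->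
  h <= h1 -> h <= h2 -> 3 <= #|covering e l h1| -> 3 <= #|covering e' l h2| ->
  #|covering (fun z => minn (e z) (e' z)) l h| <= G h.
Proof.
move=> GP GQ hh1 hh2 c1 c2; set em := fun z => _.
have leP : #|covering em l h| <= #|above e h|.
  by apply/subset_leq_card/subsetP => z; rewrite !inE /em; lia.
have leQ : #|covering em l h| <= #|above e' h|.
  by apply/subset_leq_card/subsetP => z; rewrite !inE /em; lia.
have leU : #|covering em l h| <= #|covering e l h| + #|covering e' l h|.
  apply: leq_trans (leq_card_setU _ _); apply/subset_leq_card/subsetP => z.
  by rewrite !inE /em; lia.
have bin_ge k : 3 <= k -> k.*2 <= 'C(k.+1, 2).
  by move=> k3; rewrite bin2 -[leqLHS]half_double; apply: half_leq; nia.
(* A depth below 3 at [h] is replaced by the depth 3 available at [h0], so that [bin_ge] applies. *)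
have pick e0 h0 : h <= h0 -> 3 <= #|covering e0 l h0| -> exists2 h',
    h <= h' & maxn 3 #|covering e0 l h| <= #|covering e0 l h'|.
  by move=> hh0 c0; have [?|?] := leqP #|covering e0 l h| 3; [exists h0|exists h] => //; lia.
have [h1' hh1' c1'] := pick e h1 hh1 c1.
have [h2' hh2' c2'] := pick e' h2 hh2 c2.
have [lejk|ltkj] := leqP (maxn 3 #|covering e' l h|) (maxn 3 #|covering e l h|).
  have := GP h h1' h2' _ _ hh1' hh2' c1' c2' lejk.
  by have := bin_ge (maxn 3 #|covering e' l h|) (leq_maxl _ _); lia.
have := GQ h h2' h1' _ _ hh2' hh1' c2' c1' (ltnW ltkj).
by have := bin_ge (maxn 3 #|covering e l h|) (leq_maxl _ _); lia.
Qed.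

(** Cut at the least level [t] from which on one system has depth at most 2. From [t] on, [zone_sum]
    provides [r z] levels. Below [t] both systems still reach depth 3 at or above each level, so the
    lower intervals provide the rest. *)
Lemma matched_intervals_sum G e e' l :
  staircase_bound G e e' l -> staircase_bound G e' e l ->
  (forall z, l z <= e z <= D) -> (forall z, l z <= e' z <= D) ->
  \sum_z l z <= \sum_(0 <= h < D) G h.
Proof.
move=> GP GQ leD le'D.
have eD z : e z <= D by case/andP: (leD z).
have e'D z : e' z <= D by case/andP: (le'D z).
pose deep e0 h := has (fun h1 => 3 <= #|covering e0 l h1|) (index_iota h D).
have ex_thin : exists t, ~~ (deep e t && deep e' t).
  by exists D; rewrite /deep /index_iota subnn.
case: (ex_minnP ex_thin) => t thin tmin.
have tD : t <= D by apply: tmin; rewrite /deep /index_iota subnn.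
have thinP e0 : ~~ deep e0 t -> forall h, t <= h < D -> #|covering e0 l h| <= 2.
  by move=> /hasPn tP h htD; rewrite leqNgt; apply: tP; rewrite mem_index_iota.
pose r z := minn (l z) (minn (e z - t) (e' z - t)).
have sum_high : \sum_z r z <= \sum_(t <= h < D) G h.
  move: thin; rewrite negb_and => /orP[] /thinP thin; last exact: zone_sum GP GQ eD e'D thin.
  under eq_bigr do rewrite /r (minnC (e _ - t)).
  exact: zone_sum GQ GP e'D eD thin.
have sum_low : \sum_z (l z - r z) <= \sum_(0 <= h < t) G h.
  pose em z := minn (e z) (e' z).
  apply: (double_count (V := covering em l)) => [h /andP[_ ht]|z].
    have : deep e h && deep e' h by apply: contraLR ht => /tmin; rewrite leqNgt.
    case/andP=> /hasP[h1 +  c1] /hasP[h2 + c2]; rewrite !mem_index_iota.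
    move=> /andP[hh1 _] /andP[hh2 _].
    exact: lower_interval_bound GP GQ hh1 hh2 c1 c2.
  (* The new bound is the number of levels below [t] in the lower interval of [z]. *)
  apply: (@leq_trans (minn t (em z) - (em z - l z))).
    by have := leD z; have := le'D z; rewrite /r /em; lia.
  by apply: count_interval => [||h]; rewrite ?inE; lia.
rewrite (@big_cat_nat _ _ _ t) //=; apply: leq_trans (leq_add sum_low sum_high).
by rewrite -big_split /=; apply: leq_sum => z _; rewrite /r; lia.
Qed.

End MatchedIntervals.

(** * Monomials and columns *)

Definition i0 : 'I_3 := @Ordinal 3 0 isT.
Definition i1 : 'I_3 := @Ordinal 3 1 isT.
Definition i2 : 'I_3 := @Ordinal 3 2 isT.

Lemma ord3P (P : 'I_3 -> Prop) : P i0 -> P i1 -> P i2 -> forall i, P i.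
Proof.
move=> P0 P1 P2 [[|[|[|//]]] lti].
- by rewrite (_ : Ordinal lti = i0) //; apply: val_inj.
- by rewrite (_ : Ordinal lti = i1) //; apply: val_inj.
- by rewrite (_ : Ordinal lti = i2) //; apply: val_inj.
Qed.

Definition mono_of x y h : mono := [ffun i => nth 0 [:: x; y; h] (nat_of_ord i)].

Lemma mono_ofE (a : mono) : a = mono_of (a i0) (a i1) (a i2).
Proof. by apply/ffunP; apply: ord3P; rewrite ffunE. Qed.

Lemma mono_of_inj x y h x' y' h' : mono_of x y h = mono_of x' y' h' -> [/\ x = x', y = y' & h = h'].
Proof.
by move=> e; split; [move/ffunP/(_ i0): e | move/ffunP/(_ i1): e | move/ffunP/(_ i2): e];
  rewrite !ffunE.
Qed.

Lemma shift_mono_of0 x y h : shift (mono_of x y h) i0 = mono_of x.+1 y h.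
Proof. by apply/ffunP; apply: ord3P; rewrite !ffunE /= ?addn0 ?addn1. Qed.

Lemma shift_mono_of1 x y h : shift (mono_of x y h) i1 = mono_of x y.+1 h.
Proof. by apply/ffunP; apply: ord3P; rewrite !ffunE /= ?addn0 ?addn1. Qed.

Lemma shift_mono_of2 x y h : shift (mono_of x y h) i2 = mono_of x y h.+1.
Proof. by apply/ffunP; apply: ord3P; rewrite !ffunE /= ?addn0 ?addn1. Qed.

Lemma emb_inj D : injective (@emb D).
Proof.
move=> a b /ffunP eab; apply/ffunP => i.
by apply: val_inj; have := eab i; rewrite !ffunE.
Qed.

Lemma ideal_le (I : mono -> bool) (a b : mono) :
  mono_ideal I -> (forall i, a i <= b i) -> I a -> I b.
Proof.
move=> idI leab; rewrite (mono_ofE a) (mono_ofE b).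
have up0 n x y h : I (mono_of x y h) -> I (mono_of (n + x) y h).
  by move=> Ia; elim: n => // n /(idI _ i0); rewrite shift_mono_of0.
have up1 n x y h : I (mono_of x y h) -> I (mono_of x (n + y) h).
  by move=> Ia; elim: n => // n /(idI _ i1); rewrite shift_mono_of1.
have up2 n x y h : I (mono_of x y h) -> I (mono_of x y (n + h)).
  by move=> Ia; elim: n => // n /(idI _ i2); rewrite shift_mono_of2.
rewrite -(subnK (leab i0)) -(subnK (leab i1)) -(subnK (leab i2)) => Ia.
exact/up0/up1/up2.
Qed.

Lemma ideal_mono_of (I : mono -> bool) x y h x' y' h' :
  mono_ideal I -> x <= x' -> y <= y' -> h <= h' -> I (mono_of x y h) -> I (mono_of x' y' h').
Proof.
by move=> idI lex ley leh; apply: ideal_le => //; apply: ord3P; rewrite !ffunE.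
Qed.

Lemma emb_ex D (m : mono) : (forall i, m i < D) -> exists a : {ffun 'I_3 -> 'I_D}, emb a = m.
Proof.
by move=> mD; exists [ffun i => Ordinal (mD i)]; apply/ffunP => i; rewrite !ffunE.
Qed.

Lemma QB_ex D (K I : mono -> bool) (m : mono) : bounded D I -> K m -> ~~ I m ->
  exists b : QB D K I, emb (val b) = m.
Proof.
move=> bI Km nIm; have [a am] := emb_ex (bI m nIm).
have aP : QBp K I a by rewrite /QBp am Km.
by exists (exist _ a aP).
Qed.

Lemma QB_in D (K I : mono -> bool) (b : QB D K I) :
  K (emb (val b)) /\ ~~ I (emb (val b)).
Proof. by case: b => a aP; apply/andP. Qed.

Lemma QB_emb_inj D (K I : mono -> bool) (b b' : QB D K I) :
  emb (val b) = emb (val b') -> b = b'.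
Proof. by move/emb_inj/val_inj. Qed.

Definition layer (I : mono -> bool) h : pred (nat * nat) := fun u => ~~ I (mono_of u.1 u.2 h).

Lemma young_layer I h : mono_ideal I -> young (layer I h).
Proof.
by move=> idI x y x' y' lex ley; apply: contra; apply: ideal_mono_of.
Qed.

Lemma boxed_layer D I h : bounded D I -> boxed D (layer I h).
Proof.
move=> bI x y /bI nI; have := nI i0; have := nI i1.
by rewrite !ffunE /= => -> ->.
Qed.

Lemma layer_anti I h h' u : mono_ideal I -> h <= h' -> layer I h' u -> layer I h u.
Proof. by move=> idI leh; apply: contra; apply: ideal_mono_of. Qed.

(* [p z] is the position of a column whose part in the heights covered by [z]
   consists of removable corners of the layers of [I]. *)
Definition column_system (I : mono -> bool) (Z : finType) (p : Z -> nat * nat)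
    (e l : Z -> nat) : Prop :=
  [/\ injective p,
      forall z h, h < e z -> layer I h (p z) &
      forall z h, z \in covering e l h ->
        ~~ layer I h ((p z).1.+1, (p z).2) /\ ~~ layer I h ((p z).1, (p z).2.+1)].

(** The corners at [h1] and [h2] span staircases that persist down to [h]. The columns of the second
    system reaching above [h] have distinct feet, which are cells of its layer. *)
Lemma column_system_bound D I J (Z : finType) p p' (e e' l : Z -> nat) :
  mono_ideal I -> mono_ideal J -> bounded D I -> bounded D J ->
  column_system I p e l -> column_system J p' e' l ->
  staircase_bound (fun h => size (region D (predI (layer I h) (layer J h)))) e e' l.
Proof.
move=> idI idJ bI bJ [injp inI cI] [injp' inJ cJ] h h1 h2 k j hh1 hh2 kc jc lejk.
have stairs I0 p0 e0 h0 k0 : mono_ideal I0 -> column_system I0 p0 e0 l ->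
    h <= h0 -> k0 <= #|covering e0 l h0| -> forall u, staircase k0 u -> layer I0 h u.
  move=> idI0 [injp0 inI0 cI0] hh0 kc0 u uk; apply: layer_anti hh0 _ => //.
  apply: (@staircase_corners _ (covering e0 l h0) p0) => //.
  - exact: young_layer.
  - move=> z zc; have [n1 n2] := cI0 z h0 zc; split=> //.
    by apply: inI0; move: zc; rewrite inE => /andP[].
  - exact: leq_trans uk kc0.
have sI := stairs _ _ _ _ _ idI (And3 injp inI cI) hh1 kc.
have sJ := stairs _ _ _ _ _ idJ (And3 injp' inJ cJ) hh2 jc.
apply: leq_trans (region_staircases _ _ _ sI sJ lejk);
  [|exact: young_layer|exact: boxed_layer|exact: boxed_layer].
rewrite leq_min geq_minr andbT (leq_trans (geq_minl _ _)) //.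
rewrite cardE -(size_map p'); apply: uniq_leq_size.
  by rewrite map_inj_uniq ?enum_uniq.
move=> u /mapP[z]; rewrite mem_enum inE => hz ->.
by rewrite mem_region; [apply: inJ | apply: boxed_layer].
Qed.

Lemma sum_layers D (P : mono -> bool) :
  \sum_(0 <= h < D) size (region D (fun u => P (mono_of u.1 u.2 h)))
    <= #|[set a : {ffun 'I_3 -> 'I_D} | P (emb a)]|.
Proof.
pose s := [seq mono_of u.1 u.2 h | h <- iota 0 D,
             u <- region D (fun u => P (mono_of u.1 u.2 h))].
have -> : \sum_(0 <= h < D) size (region D (fun u => P (mono_of u.1 u.2 h))) = size s.
  by rewrite size_allpairs_dep sumnE big_map /index_iota subn0.
rewrite cardE -(size_map (@emb D)); apply: uniq_leq_size.
  apply: allpairs_uniq_dep => [|h _|]; rewrite ?iota_uniq ?region_uniq //.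
  move=> u v /allpairsPdep[h [[x y] [_ _ ->]]] /allpairsPdep[h' [[x' y'] [_ _ ->]]] /=.
  by case/mono_of_inj => -> -> ->.
move=> m /allpairsPdep[h [[x y] [+ + ->]]]; rewrite mem_iota mem_filter /= => hD.
case/andP=> Pm /allpairsP[[x1 y1] /= [+ + [ex ey]]].
rewrite -ex -ey !mem_iota /= => xD yD.
have mD i : mono_of x y h i < D by move: i; apply: ord3P; rewrite !ffunE.
have [a am] := emb_ex mD.
by apply/mapP; exists a; rewrite // mem_enum inE am.
Qed.

(** * Columns of [K/I] and their images *)

Section Columns.

Variables (D : nat) (I J K L : mono -> bool) (f : QB D K I -> QB D L J).
Hypotheses (idI : mono_ideal I) (idJ : mono_ideal J) (idK : mono_ideal K).
Hypotheses (bI : bounded D I) (bJ : bounded D J) (injf : injective f).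
Hypothesis cornerI : forall b : QB D K I,
  I (shift (emb (val b)) i0) /\ I (shift (emb (val b)) i1).
Hypothesis cornerJ : forall b : QB D L J,
  J (shift (emb (val b)) i0) /\ J (shift (emb (val b)) i1).
Hypothesis f_shift : forall a b, emb (val b) = shift (emb (val a)) i2 ->
  emb (val (f b)) = shift (emb (val (f a))) i2.
Hypothesis f_top : forall a, I (shift (emb (val a)) i2) -> J (shift (emb (val (f a))) i2).

(* A column of [K/I] is represented by its top monomial. *)
Definition tops : finType := {b : QB D K I | I (shift (emb (val b)) i2)}.

Definition foot D0 (K0 I0 : mono -> bool) (b : QB D0 K0 I0) : nat * nat :=
  (nat_of_ord (val b i0), nat_of_ord (val b i1)).

Definition height D0 (K0 I0 : mono -> bool) (b : QB D0 K0 I0) : nat := val b i2.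

(** [find] returns the lowest height at which the column enters [K], so this counts the monomials of
    [K/I] in the column. *)
Definition depth (z : tops) : nat :=
  let b := val z in
  (height b).+1 - find (fun h => K (mono_of (foot b).1 (foot b).2 h)) (iota 0 (height b).+1).

Lemma emb_foot D0 (K0 I0 : mono -> bool) (b : QB D0 K0 I0) :
  emb (val b) = mono_of (foot b).1 (foot b).2 (height b).
Proof. by rewrite [LHS]mono_ofE /emb !ffunE. Qed.

(** Of two different tops over one foot, the lower one times x_3 would divide the higher one and put
    it into [I0]. *)
Lemma foot_top_inj D0 (K0 I0 : mono -> bool) (b b' : QB D0 K0 I0) : mono_ideal I0 ->
  I0 (shift (emb (val b)) i2) -> I0 (shift (emb (val b')) i2) -> foot b = foot b' -> b = b'.
Proof.
move=> idI0 tb tb' eb; apply: QB_emb_inj; rewrite !emb_foot eb.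
have [_ nb] := QB_in b; have [_ nb'] := QB_in b'.
move: tb tb' nb nb'; rewrite !emb_foot eb !shift_mono_of2 => tb tb' nb nb'.
congr mono_of; apply/eqP; rewrite eqn_leq; apply/andP; split; rewrite leqNgt.
  by apply: contra nb => lt; apply: ideal_mono_of tb'.
by apply: contra nb' => lt; apply: ideal_mono_of tb.
Qed.

Lemma depthP (z : tops) h : h < (height (val z)).+1 ->
  K (mono_of (foot (val z)).1 (foot (val z)).2 h) = ((height (val z)).+1 - depth z <= h).
Proof.
move=> hz; rewrite /depth; set s := find _ _.
have sP : s <= (height (val z)).+1 by rewrite -[leqRHS](size_iota 0) find_size.
rewrite subKn //; apply/idP/idP => [Kh|sh].
  rewrite leqNgt; apply/negP => /(before_find 0).
  by rewrite nth_iota ?add0n ?Kh.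
have hs : has (fun h => K (mono_of (foot (val z)).1 (foot (val z)).2 h)) (iota 0 (height (val z)).+1).
  by rewrite has_find size_iota -/s; lia.
have := nth_find 0 hs; rewrite -/s nth_iota ?add0n; last lia.
exact: ideal_mono_of.
Qed.

Lemma depth_le (z : tops) : 0 < depth z <= (height (val z)).+1.
Proof.
rewrite [X in _ && X]leq_subr andbT ltnNge leqn0; apply/negP => /eqP d0.
have := @depthP z (height (val z)) (ltnSn _); rewrite d0 subn0 ltnn -emb_foot.
by have [-> _] := QB_in (val z).
Qed.

Lemma layer_top (z : tops) h : h < (height (val z)).+1 -> layer I h (foot (val z)).
Proof.
move=> hz; have [_] := QB_in (val z); rewrite emb_foot; apply: contra.
exact: ideal_mono_of.
Qed.

Lemma column_ex (z : tops) h : h \in iota ((height (val z)).+1 - depth z) (depth z) ->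
  exists2 b : QB D K I, foot b = foot (val z) & height b = h.
Proof.
rewrite mem_iota => hz; have dz := depth_le z.
have hz' : h < (height (val z)).+1 by lia.
have [|b eb] := @QB_ex D K I (mono_of (foot (val z)).1 (foot (val z)).2 h) bI _ (layer_top hz').
  by rewrite depthP //; lia.
move: eb; rewrite emb_foot => /mono_of_inj[e0 e1 e2]; exists b => //.
by rewrite [LHS]surjective_pairing e0 e1 -surjective_pairing.
Qed.

(** Descend from the top: as [f] commutes with x_3, the monomial [i] steps below the top goes to the
    one [i] steps below the image of the top. *)
Lemma f_column (z : tops) i : i < depth z -> exists b : QB D K I,
  [/\ foot b = foot (val z), height b = height (val z) - i, foot (f b) = foot (f (val z)),
      i <= height (f (val z)) & height (f b) = height (f (val z)) - i].
Proof.
have dz := depth_le z.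
elim: i => [|i IHi] iz; first by exists (val z); rewrite !subn0.
have [b [fb hb fbf ih hbf]] := IHi (ltnW iz).
have [|b' fb' hb'] := @column_ex z (height (val z) - i.+1).
  by rewrite mem_iota; lia.
have := @f_shift b' b; rewrite !emb_foot fb hb fb' hb' fbf hbf !shift_mono_of2.
rewrite (_ : _ - i = (height (val z) - i.+1).+1); last lia.
move=> /(_ erefl) /mono_of_inj[e0 e1 e2]; exists b'; split=> //; last by lia.
  by rewrite [LHS]surjective_pairing -e0 -e1 -surjective_pairing.
lia.
Qed.

Lemma column_systemI : column_system I (fun z : tops => foot (val z))
  (fun z => (height (val z)).+1) depth.
Proof.
split=> [z z' ezz'|z h|z h].
- by apply: val_inj; apply: foot_top_inj ezz'; rewrite ?(valP z) ?(valP z').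
- exact: layer_top.
rewrite inE => hz; have dz := depth_le z.
have [|b fb hb] := @column_ex z h; first by rewrite mem_iota; lia.
have [] := cornerI b; rewrite emb_foot fb hb shift_mono_of0 shift_mono_of1.
by rewrite /layer /= => -> ->.
Qed.

Lemma column_systemJ : column_system J (fun z : tops => foot (f (val z)))
  (fun z => (height (f (val z))).+1) depth.
Proof.
split=> [z z' ezz'|z h hz|z h].
- apply: val_inj; apply: injf; apply: foot_top_inj ezz' => //; apply: f_top.
    exact: (valP z).
  exact: (valP z').
- have [_] := QB_in (f (val z)); rewrite emb_foot; apply: contra.
  exact: ideal_mono_of.
rewrite inE => hz; have dz := depth_le z.
have [|b [_ _ fb _ hb]] := @f_column z (height (f (val z)) - h); first lia.
have [] := cornerJ (f b); rewrite emb_foot fb hb shift_mono_of0 shift_mono_of1 subKn; last lia.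
by rewrite /layer /= => -> ->.
Qed.

Lemma card_QB_depth : #|QB D K I| <= \sum_z depth z.
Proof.
pose s := [seq (foot (val z), h) | z : tops <- enum tops,
             h <- iota ((height (val z)).+1 - depth z) (depth z)].
have -> : \sum_z depth z = size s.
  rewrite size_allpairs_dep sumnE big_map big_enum /=.
  by apply: eq_bigr => z _; rewrite size_iota.
rewrite cardE -(size_map (fun b => (foot b, height b))); apply: uniq_leq_size.
  rewrite map_inj_uniq ?enum_uniq // => b b' [e0 e1 e2]; apply: QB_emb_inj.
  by rewrite !emb_foot /= /foot /= e0 e1 e2.
move=> u /mapP[b _ ->].
have bdh h : ~~ I (mono_of (foot b).1 (foot b).2 h) -> h <= D.
  by move/bI/(_ i2); rewrite ffunE /=; lia.
have [Kb nIb] := QB_in b.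
have exh : exists h, ~~ I (mono_of (foot b).1 (foot b).2 h).
  by exists (height b); rewrite -emb_foot.
(* The highest monomial outside [I] over the foot of [b] is a multiple of [b], hence lies in [K] and
   is a top. *)
case: (ex_maxnP exh bdh) => h nIh hmax.
have bh : height b <= h by apply: hmax; rewrite -emb_foot.
have [|c] := @QB_ex D K I _ bI _ nIh.
  by move: Kb; rewrite emb_foot; apply: ideal_mono_of.
rewrite emb_foot => /mono_of_inj[e0 e1 e2].
have topc : I (shift (emb (val c)) i2).
  rewrite emb_foot e0 e1 e2 shift_mono_of2.
  by apply: contraT => /hmax; rewrite ltnn.
pose z : tops := exist _ c topc.
have zb : foot (val z) = foot b by rewrite [LHS]surjective_pairing e0 e1 -surjective_pairing.
apply/allpairsPdep; exists z, (height b); rewrite mem_enum zb; split=> //.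
rewrite mem_iota; have dz := depth_le z.
have hb : height b < (height (val z)).+1 by rewrite /= e2; lia.
by have := depthP hb; rewrite zb -emb_foot Kb; lia.
Qed.

Lemma card_QB_le : #|QB D K I| <=
  #|[set a : {ffun 'I_3 -> 'I_D} | ~~ I (emb a) && ~~ J (emb a)]|.
Proof.
apply: leq_trans card_QB_depth _.
apply: leq_trans (sum_layers D (fun m => ~~ I m && ~~ J m)).
have GP := column_system_bound idI idJ bI bJ column_systemI column_systemJ.
have GQ := column_system_bound idJ idI bJ bI column_systemJ column_systemI.
apply: matched_intervals_sum GP _ _ _ => [|z|z].
- move=> h h1 h2 k j hh1 hh2 kc jc jk; have := GQ h h1 h2 k j hh1 hh2 kc jc jk.
  rewrite (_ : region D (predI _ _) = region D (predI (layer I h) (layer J h))) //.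
  by apply: eq_filter => u; rewrite /= andbC.
- have := depth_le z; have := ltn_ord (val (val z) i2); rewrite -/(height _); lia.
- have dz := depth_le z; have := ltn_ord (val (f (val z)) i2).
  (* The last step of the descent stays at nonnegative height, so the image column is high enough
     for this depth. *)
  have [|b] := @f_column z (depth z).-1; first by lia.
  by case=> _ _ _ + _; rewrite -/(height _); lia.
Qed.

End Columns.

(** * Linear algebra *)

Import GRing.Theory.
Local Open Scope ring_scope.

Section IndexedMatrices.

Variable k : fieldType.

Lemma mx_of_inj (T U : finType) (f g : T -> U -> k) : mx_of f = mx_of g -> f =2 g.
Proof.
move=> /matrixP efg t u; have := efg (enum_rank t) (enum_rank u).
by rewrite !mxE !enum_rankK.
Qed.

Lemma eq_mx_of (T U : finType) (f g : T -> U -> k) : f =2 g -> mx_of f = mx_of g.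
Proof. by move=> efg; apply/matrixP => i j; rewrite !mxE. Qed.

Lemma mul_mx_of (T U V : finType) (f : T -> U -> k) (g : U -> V -> k) :
  mx_of f *m mx_of g = mx_of (fun t v => \sum_u f t u * g u v).
Proof.
apply/matrixP => i j; rewrite !mxE (reindex (@enum_rank U)) /=; last first.
  by apply: onW_bij; apply: enum_rank_bij.
by apply: eq_bigr => u _; rewrite !mxE enum_rankK.
Qed.

Lemma mx_of1 (T : finType) : mx_of (fun t u : T => (t == u)%:R : k) = 1%:M.
Proof. by apply/matrixP => i j; rewrite !mxE (inj_eq enum_val_inj). Qed.

Lemma sum_indicator (T : finType) (P : pred T) (t : T) (F : T -> k) :
  P =1 pred1 t -> \sum_u F u * (P u)%:R = F t.
Proof.
move=> Pt; rewrite (bigD1 t) //= Pt /= eqxx mulr1 big1 ?addr0 // => u /negbTE nu.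
by rewrite Pt /= nu mulr0.
Qed.

Lemma natr_bool_inj (b c : bool) : b%:R = c%:R :> k -> b = c.
Proof. by case: b c => [] [] // /eqP; rewrite ?oner_eq0 // eq_sym oner_eq0. Qed.

End IndexedMatrices.

Section Corners.

Variables (k : fieldType) (D : nat).

Lemma actQ0_corner (K I : mono -> bool) i : mono_ideal K -> bounded D I ->
  actQ k D K I i = 0 -> forall b : QB D K I, I (shift (emb (val b)) i).
Proof.
move=> idK bI act0 b; apply: contraT => nI.
have [Kb _] := QB_in b.
have [b' eb'] := QB_ex bI (idK _ _ Kb) nI.
have /mx_of_inj/(_ b' b) : actQ k D K I i = mx_of (fun _ _ => 0).
  by rewrite act0; apply/matrixP => ? ?; rewrite !mxE.
by rewrite eb' eqxx => /eqP; rewrite oner_eq0.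
Qed.

Lemma smod_iso_actQ0 r (n : 'I_r -> nat) (K I : mono -> bool) i : i != i2 ->
  smod_iso (actQ k D K I) (actN k n) -> actQ k D K I i = 0.
Proof.
move=> ni [P [_ Pfull eP]]; apply: (row_full_inj Pfull); rewrite mulmx0 eP.
rewrite (_ : actN k n i = 0) ?mul0mx //; apply/matrixP => u v; rewrite !mxE.
by rewrite (_ : (nat_of_ord i == 2%N) = false) //; apply: contraNF ni.
Qed.

End Corners.

(** * Isomorphisms sending monomials to monomials *)

Section MonomialIso.

Variables (k : fieldType) (D : nat) (I J K L : mono -> bool).
Variable sigma : QB D K I -> QB D L J.
Hypothesis iso : mono_smod_iso k sigma.

Lemma mono_iso_inj : injective sigma.
Proof.
case: iso => _ Pfull _ a a' eaa'.
pose d (b : QB D K I) := mx_of (fun (x : QB D K I) (_ : 'I_1) => ((x == b)%:R : k)).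
have dE b : mono_map k sigma *m d b = mx_of (fun c (_ : 'I_1) => ((sigma b == c)%:R : k)).
  by rewrite mul_mx_of; apply: eq_mx_of => c o; apply: sum_indicator.
have : d a = d a' by apply: (row_full_inj Pfull); rewrite !dE eaa'.
move=> /mx_of_inj/(_ a ord0)/natr_bool_inj; rewrite eqxx => /esym/eqP //.
Qed.

Lemma mono_iso_card : #|QB D K I| = #|QB D L J|.
Proof. by case: iso => /eqP Pfree /eqP Pfull _; rewrite -Pfree Pfull. Qed.

Lemma mono_iso_surj c : exists b, sigma b = c.
Proof.
have [g _ gK] := inj_card_bij mono_iso_inj (eq_leq (esym mono_iso_card)).
by exists (g c).
Qed.

Lemma mono_iso_shift a b i : emb (val b) = shift (emb (val a)) i ->
  emb (val (sigma b)) = shift (emb (val (sigma a))) i.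
Proof.
(* Compare the entries in row [sigma b] and column [a] of the intertwining relation. *)
move=> eb; case: iso => _ _ /(_ i); rewrite !mul_mx_of => /mx_of_inj/(_ (sigma b) a).
rewrite (sum_indicator (t := b)) => [|x]; last first.
  by rewrite /= -eb; apply/eqP/eqP => [/QB_emb_inj | ->].
rewrite (sum_indicator (t := sigma a)) => [|x]; last by rewrite /= eq_sym.
by move/natr_bool_inj; rewrite eqxx => /esym/eqP.
Qed.

(** Were the product nonzero, it would be a monomial [c] of [L/J], and the two sides of the
    intertwining relation would have the entries 0 and 1 at (c, a). *)
Lemma mono_iso_top a i : mono_ideal L -> bounded D J ->
  I (shift (emb (val a)) i) -> J (shift (emb (val (sigma a))) i).
Proof.
move=> idL bJ Ia; apply: contraT => nJ.
have [La _] := QB_in (sigma a).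
have [c ec] := QB_ex bJ (idL _ _ La) nJ.
case: iso => _ _ /(_ i); rewrite !mul_mx_of => /mx_of_inj/(_ c a).
rewrite [RHS](sum_indicator (t := sigma a)) => [|x]; last by rewrite /= eq_sym.
rewrite ec eqxx big1 => [/esym/eqP|b _]; first by rewrite oner_eq0.
case: (emb (val b) =P _) => [eb|_]; last by rewrite mulr0.
by have [_] := QB_in b; rewrite eb Ia.
Qed.

Lemma mono_iso_actQ0 i : actQ k D K I i = 0 -> actQ k D L J i = 0.
Proof.
case: iso => Pfree _ /(_ i) eP a0; apply: (row_free_inj Pfree).
by rewrite /= -eP a0 mulmx0 mul0mx.
Qed.

End MonomialIso.

(** * The glued module and its algebra *)

Section GluedModule.

Variables (k : fieldType) (D : nat) (I J K L : mono -> bool).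
Variable sigma : QB D K I -> QB D L J.
Hypotheses (idI : mono_ideal I) (idJ : mono_ideal J) (idK : mono_ideal K) (idL : mono_ideal L).
Hypotheses (bI : bounded D I) (bJ : bounded D J).
Hypotheses (JL : forall a, J a -> L a) (iso : mono_smod_iso k sigma).

Let B := MB D I L.
Implicit Types (u v : mono + mono) (b : B) (w : seq 'I_3) (e : mono).

(* The basis monomial of [M] equal to [u], or [None] if [u] vanishes in [M]. *)
Definition basis_of u : option B := [pick b : B | std_at I J u && identified sigma u (rep b)].

Lemma identified_inl_inr a c : ~~ L c -> ~~ identified sigma (inl a) (inr c).
Proof.
move=> nL; apply/negP => /orP[//|/existsP[x /andP[_ /eqP ex]]].
by have [] := QB_in (sigma x); rewrite ex (negbTE nL).
Qed.

Lemma identified_inl_inl a a' : identified sigma (inl a) (inl a') = (a == a').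
Proof. by rewrite /identified orbF. Qed.

Lemma identified_inr_inr c c' : identified sigma (inr c) (inr c') = (c == c').
Proof. by rewrite /identified orbF. Qed.

Lemma identified_inr_inl a c : identified sigma (inr c) (inl a) ->
  exists2 x, emb (val x) = a & emb (val (sigma x)) = c.
Proof. by case/orP=> // /existsP[x /andP[/eqP ex /eqP ey]]; exists x. Qed.

(** [sigma] takes values in [L], which the basis monomials coming from [S/J] avoid; two
    identifications with monomials of [S/I] agree because [sigma] is injective. *)
Lemma identified_uniq u b b' :
  identified sigma u (rep b) -> identified sigma u (rep b') -> b = b'.
Proof.
have nL (c : {c : {ffun 'I_3 -> 'I_D} | ~~ L (emb c)}) : ~~ L (emb (val c)) := valP c.
have noL x c : ~~ L c -> emb (val (sigma x)) = c -> False.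
  by move=> nLc ex; have [] := QB_in (sigma x); rewrite ex (negbTE nLc).
case: u b b' => [a|c] [b|b] [b'|b'] /=;
  rewrite ?identified_inl_inl ?identified_inr_inr ?(negbTE (identified_inl_inr _ (nL _))) //.
- by move=> /eqP -> /eqP/emb_inj/val_inj ->.
- move=> /identified_inr_inl[x xb xc] /identified_inr_inl[x' xb' xc'].
  have xx' : x = x' by apply: (mono_iso_inj iso); apply: QB_emb_inj; rewrite xc xc'.
  by congr inl; apply: val_inj; apply: emb_inj; rewrite -xb -xb' xx'.
- by move=> /identified_inr_inl[x _ xc] /eqP cb; case: (noL x c) => //; rewrite cb; exact: nL.
- by move=> /eqP cb /identified_inr_inl[x _ xc]; case: (noL x c) => //; rewrite cb; exact: nL.
- by move=> /eqP -> /eqP/emb_inj/val_inj ->.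
Qed.

Lemma basis_ofE u b : (basis_of u == Some b) = std_at I J u && identified sigma u (rep b).
Proof.
rewrite /basis_of; case: pickP => [b' /andP[su ub']|none]; last by rewrite none.
rewrite su /=; apply/eqP/idP => [[<-] //|ub]; congr Some.
exact: identified_uniq ub' ub.
Qed.

Lemma basis_of_rep b : basis_of (rep b) = Some b.
Proof.
apply/eqP; rewrite basis_ofE /identified eqxx orTb andbT.
case: b => b /=; first exact: (valP b).
by apply: contra (valP b); apply: JL.
Qed.

Lemma basis_of_nonstd u : ~~ std_at I J u -> basis_of u = None.
Proof. by move=> nu; rewrite /basis_of; case: pickP => // b; rewrite (negbTE nu). Qed.

Lemma basis_of_inl (a : mono) : ~~ I a -> exists b, basis_of (inl a) = Some b.
Proof.
move=> nIa; have [c ca] := emb_ex (bI nIa).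
have nIc : ~~ I (emb c) by rewrite ca.
exists (inl (exist _ c nIc)); apply/eqP.
by rewrite basis_ofE /= nIa identified_inl_inl /= ca eqxx.
Qed.

Lemma basis_of_glue x : basis_of (inr (emb (val (sigma x)))) = basis_of (inl (emb (val x))).
Proof.
have [_ nIx] := QB_in x; have [_ nJx] := QB_in (sigma x).
have [b nfb] := basis_of_inl nIx; rewrite nfb; apply/eqP.
move/eqP: nfb; rewrite !basis_ofE /= nIx nJx /=.
case: b => b /=; last by rewrite (negbTE (identified_inl_inr _ (valP b))).
rewrite identified_inl_inl => /eqP <-.
by apply/orP; right; apply/existsP; exists x; rewrite !eqxx.
Qed.

Lemma basis_of_ex u : std_at I J u -> exists b, basis_of u = Some b.
Proof.
case: u => [a|c] /=; first exact: basis_of_inl.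
move=> nJc; case Lc: (L c).
  have [y yc] := QB_ex bJ Lc nJc; have [x xy] := mono_iso_surj iso y.
  by rewrite -yc -xy basis_of_glue; apply: basis_of_inl; case: (QB_in x).
have [c' cc'] := emb_ex (bJ nJc).
have nLc' : ~~ L (emb c') by rewrite cc' Lc.
exists (inr (exist _ c' nLc')); apply/eqP.
by rewrite basis_ofE /= nJc identified_inr_inr /= cc' eqxx.
Qed.

(** Multiplication by a variable descends to the quotient. Only glued pairs need an argument:
    [mono_iso_top] if the product vanishes, [mono_iso_shift] otherwise. *)
Lemma basis_of_shift u b i : basis_of u = Some b -> basis_of (shiftS u i) = basis_of (shiftS (rep b) i).
Proof.
move=> /eqP; rewrite basis_ofE => /andP[su].
case: u b su => [a|c] [b|b] /= su.
- by rewrite identified_inl_inl => /eqP ->.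
- by rewrite (negbTE (identified_inl_inr _ (valP b))).
- move=> /identified_inr_inl[x <- <-].
  case Ix: (I (shift (emb (val x)) i)).
    rewrite !basis_of_nonstd //= ?Ix //.
    by rewrite (mono_iso_top iso idL bJ).
  have [Kx _] := QB_in x.
  have [|y yx] := QB_ex bI (idK i Kx) _; first by rewrite Ix.
  by rewrite -yx -(mono_iso_shift iso yx) basis_of_glue.
- by rewrite identified_inr_inr => /eqP ->.
Qed.

Lemma basis_of_shift_none u i : basis_of u = None -> basis_of (shiftS u i) = None.
Proof.
move=> nu; apply: basis_of_nonstd.
have : ~~ std_at I J u by apply/negP => /basis_of_ex[b]; rewrite nu.
by case: u {nu} => a /=; rewrite !negbK; [apply: idI|apply: idJ].
Qed.

Definition exponent w : mono := [ffun j => count_mem j w].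

Definition addS u e : mono + mono :=
  match u with
  | inl a => inl [ffun j => (a j + e j)%N]
  | inr a => inr [ffun j => (a j + e j)%N]
  end.

(** Multiplication on [M] by the monomial of exponent [e]. *)
Definition mono_mx e : 'M[k]_(#|B|, #|B|) :=
  mx_of (fun b' b => (basis_of (addS (rep b) e) == Some b')%:R).

Lemma AmatE i : Amat k sigma i = mx_of (fun b' b => (basis_of (shiftS (rep b) i) == Some b')%:R).
Proof. by apply: eq_mx_of => b' b; rewrite basis_ofE. Qed.

Lemma addS_nil u : addS u (exponent [::]) = u.
Proof. by case: u => a /=; congr (_ _); apply/ffunP => j; rewrite !ffunE addn0. Qed.

Lemma addS_cons u i w : addS u (exponent (i :: w)) = shiftS (addS u (exponent w)) i.
Proof.
by case: u => a /=; congr (_ _); apply/ffunP => j; rewrite !ffunE /= eq_sym; lia.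
Qed.

Lemma wprodE w : wprod (Amat k sigma) w = mono_mx (exponent w).
Proof.
elim: w => [|i w IHw] /=.
  rewrite -mx_of1; apply: eq_mx_of => b' b.
  by rewrite addS_nil basis_of_rep; congr (_%:R); rewrite eq_sym.
rewrite IHw AmatE mul_mx_of; apply: eq_mx_of => b' b; rewrite addS_cons.
case nfu: (basis_of (addS (rep b) (exponent w))) => [c|].
  by rewrite (basis_of_shift _ nfu) (sum_indicator (t := c)) // => c' /=; rewrite eq_sym.
by rewrite (basis_of_shift_none _ nfu) big1 // => c _; rewrite mulr0.
Qed.

Lemma mono_mx_eq0 e : I e -> J e -> mono_mx e = 0.
Proof.
move=> Ie Je; apply/matrixP => i j; rewrite !mxE basis_of_nonstd //.
case: (rep _) => a /=; rewrite negbK.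
  by apply: ideal_le Ie => // x; rewrite ffunE leq_addl.
by apply: ideal_le Je => // x; rewrite ffunE leq_addl.
Qed.

(** A monomial in both [I] and [J] kills [M], so every word is zero or the matrix of a monomial
    outside one of the two ideals. *)
Lemma dim_words_span m :
  (\dim (words_span (Amat k sigma) m) <=
     #|[set a : {ffun 'I_3 -> 'I_D} | ~~ I (emb a)] :|: [set a | ~~ J (emb a)]|)%N.
Proof.
set S := _ :|: _; pose X := [seq mono_mx (emb a) | a <- enum S].
have sX : (words_span (Amat k sigma) m <= <<X>>)%VS.
  apply/subv_sumP => j _; apply/span_subvP => _ /mapP[w _ ->]; rewrite wprodE.
  set e := exponent _.
  have [/andP[Ie Je]|] := boolP (I e && J e); first by rewrite mono_mx_eq0 ?mem0v.
  rewrite negb_and => std.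
  have eD i : (e i < D)%N by case/orP: std => [/bI|/bJ].
  have [a ae] := emb_ex eD.
  apply: memv_span; apply/mapP; exists a; last by rewrite ae.
  by rewrite mem_enum !inE ae.
by apply: leq_trans (dimvS sX) _; apply: leq_trans (dim_span _) _; rewrite size_map -cardE.
Qed.

End GluedModule.

Theorem theorem1p1 (k : fieldType) (D : nat) (I J K L : mono -> bool)
  (r : nat) (n : 'I_r -> nat) (sigma : QB D K I -> QB D L J) :
  mono_ideal I -> mono_ideal J -> mono_ideal K -> mono_ideal L ->
  (forall a, I a -> K a) -> (forall a, J a -> L a) ->
  bounded D I -> bounded D J ->
  (forall j, (0 < n j)%N) ->
  smod_iso (actQ k D K I) (actN k n) ->
  mono_smod_iso k sigma ->
  forall m : nat, (\dim (words_span (Amat k sigma) m) <= #|MB D I L|)%N.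
Proof.
move=> idI idJ idK idL _ JL bI bJ _ isoN iso m.
apply: leq_trans (dim_words_span idI idJ idK idL bI bJ JL iso m) _.
have actI i : i != i2 -> actQ k D K I i = 0 by move=> ni; apply: smod_iso_actQ0 isoN.
have actJ i : i != i2 -> actQ k D L J i = 0 by move=> /actI/(mono_iso_actQ0 iso).
have cornerI (b : QB D K I) : I (shift (emb (val b)) i0) /\ I (shift (emb (val b)) i1).
  by split; apply: actQ0_corner => //; apply: actI.
have cornerJ (b : QB D L J) : J (shift (emb (val b)) i0) /\ J (shift (emb (val b)) i1).
  by split; apply: actQ0_corner => //; apply: actJ.
have := card_QB_le idI idJ idK bI bJ (mono_iso_inj iso) cornerI cornerJ
  (fun a b => @mono_iso_shift _ _ _ _ _ _ _ iso a b i2)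
  (fun a => @mono_iso_top _ _ _ _ _ _ _ iso a i2 idL bJ).
rewrite (mono_iso_card iso) [#|QB D L J|]card_sig card_sum !card_sig.
set SI := [set a | ~~ I _]; set SJ := [set a | ~~ J _].
have -> : [set a : {ffun 'I_3 -> 'I_D} | ~~ I (emb a) && ~~ J (emb a)] = SI :&: SJ.
  by apply/setP => a; rewrite !inE.
have -> : #|[pred x : {ffun 'I_3 -> 'I_D} | ~~ I (emb x)]| = #|SI| by apply: eq_card => a; rewrite !inE.
(* Splitting the monomials of [S/J] along [L] and using inclusion-exclusion for [SI] and [SJ], the
   claim becomes the bound of [card_QB_le]. *)
have cJ : #|SJ| = (#|[pred x : {ffun 'I_3 -> 'I_D} | ~~ L (emb x)]| +
                   #|[pred x : {ffun 'I_3 -> 'I_D} | QBp L J x]|)%N.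
  rewrite -(cardID [pred x | ~~ L (emb x)] SJ).
  congr (_ + _)%N; apply: eq_card => a; rewrite !inE ?negbK //.
  by rewrite andbC; case La: (L _) => //=; apply/negP => /JL; rewrite La.
by move=> leW; rewrite cardsU cJ leq_subLR addnA addnC leq_add2r.
Qed.
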